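(* There exist absolute constants $c, C > 0$ such that for every $\epsilon \in (0,1)$, $$c\,\epsilon^{-4/3} \le f(3,\epsilon) \le C\,\epsilon^{-7/4}.$$
   Context: A plank of width $\epsilon$ in $\mathbb{R}^d$ is the closed region bounded by two parallel hyperplanes at distance $\epsilon$ from each other. A finite collection of planks $P_1,\ldots,P_f$ permits a non-dissective translative covering of a convex body $K\subset\mathbb{R}^d$ if there exist a permutation $\sigma$ of $\{1,\ldots,f\}$ and translates $P'_i$ of $P_i$ ($i=1,\ldots,f$) such that $K\setminus\bigcup_{i=1}^j P'_{\sigma(i)}$ is a connected set for every $j=1,\ldots,f$, and is empty for $j=f$ (the empty set counts as connected). For $\epsilon>0$, $f(d,\epsilon)$ denotes the smallest positive integer $f$ such that every collection of $f$ planks of width $\epsilon$ in $\mathbb{R}^d$ permits a non-dissective translative covering of the unit ball $B^d$ (the ball of radius $1$) in $\mathbb{R}^d$. *)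

(* Defs.v *)
From HB Require Import structures.
From mathcomp Require Import all_boot all_order all_algebra all_fingroup.
From mathcomp Require Import all_classical all_reals all_analysis.

Set Implicit Arguments.
Unset Strict Implicit.
Unset Printing Implicit Defensive.

Import Order.TTheory GRing.Theory Num.Theory.
Import numFieldNormedType.Exports.

Local Open Scope classical_set_scope.
Local Open Scope ring_scope.

(* The library norm on row vectors is the sup norm, hence the explicit
   Euclidean structure here. The topology on 'rV[R]_d is the usual one. *)
Definition dotprod (R : realType) (d : nat) (u v : 'rV[R]_d) : R :=
  \sum_(i < d) u 0 i * v 0 i.

Definition euclidean_norm (R : realType) (d : nat) (u : 'rV[R]_d) : R :=
  Num.sqrt (dotprod u u).

Definition unit_ball (R : realType) (d : nat) : set 'rV[R]_d :=
  [set x | euclidean_norm x <= 1].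

(* u is the unit normal, so the bounding hyperplanes dotprod u x = a and
   dotprod u x = a + eps are at distance eps. *)
Definition is_plank (R : realType) (d : nat) (eps : R) (P : set 'rV[R]_d) :
    Prop :=
  exists (u : 'rV[R]_d) (a : R), euclidean_norm u = 1 /\
    P = [set x | a <= dotprod u x <= a + eps].

Definition translate (R : realType) (d : nat) (t : 'rV[R]_d)
    (P : set 'rV[R]_d) : set 'rV[R]_d :=
  (fun x => x + t) @` P.

(* Indices start at 0, so [i < j] selects the first j planks in the order
   given by sigma. *)
Definition uncovered (R : realType) (d : nat) (K : set 'rV[R]_d) (f : nat)
    (P : 'I_f -> set 'rV[R]_d) (sigma : 'S_f) (j : nat) : set 'rV[R]_d :=
  K `\` \bigcup_(i in [set i : 'I_f | (i < j)%N]) P (sigma i).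

(* The empty set is [connected]. *)
Definition nondissective_translative_covering (R : realType) (d : nat)
    (K : set 'rV[R]_d) (f : nat) (P : 'I_f -> set 'rV[R]_d) : Prop :=
  exists (sigma : 'S_f) (t : 'I_f -> 'rV[R]_d),
    let P' := fun i => translate (t i) (P i) in
    (forall j : nat, (1 <= j <= f)%N -> connected (uncovered K P' sigma j)) /\
    uncovered K P' sigma f = set0.

Definition always_covers (R : realType) (d : nat) (eps : R) (f : nat) : Prop :=
  forall P : 'I_f -> set 'rV[R]_d, (forall i, is_plank eps (P i)) ->
    nondissective_translative_covering (@unit_ball R d) P.

(* The smallest positive f with [always_covers d eps f]. The value is 0 if
   there is none, so a positive lower bound on it asserts existence. *)
Definition nondissective_number (R : realType) (d : nat) (eps : R) : nat :=
  xget 0%N [set f : nat | [/\ (0 < f)%N, always_covers d eps f &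
    forall g : nat, (0 < g)%N -> always_covers d eps g -> (f <= g)%N]].

(* Main.v *)
(* If K is convex and the uncovered part of K minus a plank is connected, then
   the plank cuts a cap off K; so a non-dissective covering is a sequence of
   cap cuts.

   Lower bound.  Take f <= N^2 normals proportional to (al, be, 1), with (al, be)
   in the grid (Z/N)^2 and 1/N about eps^(2/3).  If a cap contains two points far
   apart in the y direction and two far apart in the x direction, then the point
   just above their mean was cut off earlier by some plank i that missed the
   four points; as the slopes of i differ by at least 1/N, one of the two
   distances is O(N eps) = O(eps^(1/3)).  Hence each cap is thin: it contains
   only a proportion O(eps^(4/3)) of the points of a fine grid.

   Upper bound.  At least f/3 of the planks have, up to the order of the
   coordinates, normals proportional to (a, b, 1) with |a|, |b| <= 1.  Process
   them by increasing a and always cut a cap from the top.  Project K along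
   (1, 0, -a) to a plane convex set, with coordinates y and z + a x.  A cut of
   depth eps and chord length l removes area at least about eps l and perimeter
   at least about eps^2 / l, hence decreases area + perimeter by at least about
   eps^(3/2), while rotating the direction of projection increases this sum by
   only O(1) in total.  So O(eps^(-3/2)) cuts suffice, and this is at most
   O(eps^(-7/4)).  A discretized version of area + perimeter is used, made of
   N = O(eps^(-1/2)) suprema over K, each of which is Lipschitz in a. *)
Require Import Defs.
From HB Require Import structures.
From mathcomp Require Import all_boot all_order all_algebra all_fingroup.
From mathcomp Require Import all_classical all_reals all_analysis.
From mathcomp Require Import ring lra.

Import Order.TTheory GRing.Theory Num.Theory.
Import numFieldNormedType.Exports.

Local Open Scope classical_set_scope.
Local Open Scope ring_scope.

Set Implicit Arguments.
Unset Strict Implicit.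
Unset Printing Implicit Defensive.

(** * Convexity, connectedness and planks *)

Lemma dotprodDr (R : realType) (d : nat) (u x y : 'rV[R]_d) :
  dotprod u (x + y) = dotprod u x + dotprod u y.
Proof.
by rewrite /dotprod -big_split; apply: eq_bigr => i _; rewrite mxE mulrDr.
Qed.

Lemma dotprodZr (R : realType) (d : nat) (u x : 'rV[R]_d) (k : R) :
  dotprod u (k *: x) = k * dotprod u x.
Proof.
by rewrite /dotprod mulr_sumr; apply: eq_bigr => i _; rewrite mxE mulrCA.
Qed.

Lemma dotprodBr (R : realType) (d : nat) (u x y : 'rV[R]_d) :
  dotprod u (x - y) = dotprod u x - dotprod u y.
Proof. by rewrite -scaleN1r dotprodDr dotprodZr mulN1r. Qed.

Lemma dotprodC (R : realType) (d : nat) (u v : 'rV[R]_d) :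
  dotprod u v = dotprod v u.
Proof. by apply: eq_bigr => i _; rewrite mulrC. Qed.

Lemma dotprodNl (R : realType) (d : nat) (u x : 'rV[R]_d) :
  dotprod (- u) x = - dotprod u x.
Proof. by rewrite dotprodC -scaleN1r dotprodZr mulN1r dotprodC. Qed.

Lemma dotprod_ge0 (R : realType) (d : nat) (u : 'rV[R]_d) : 0 <= dotprod u u.
Proof. by apply: sumr_ge0 => i _; rewrite -expr2 sqr_ge0. Qed.

Lemma euclidean_norm_le1 (R : realType) (d : nat) (u : 'rV[R]_d) :
  (euclidean_norm u <= 1) = (dotprod u u <= 1).
Proof. by rewrite /euclidean_norm -{1}sqrtr1 ler_sqrt ?ltr01. Qed.

Lemma euclidean_norm_eq1 (R : realType) (d : nat) (u : 'rV[R]_d) :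
  euclidean_norm u = 1 <-> dotprod u u = 1.
Proof.
rewrite /euclidean_norm; split=> [h|->]; last exact: sqrtr1.
by rewrite -[LHS]sqr_sqrtr ?dotprod_ge0 // h expr1n.
Qed.

Lemma unit_ball_coord (R : realType) (d : nat) (x : 'rV[R]_d) (i : 'I_d) :
  unit_ball x -> `|x 0 i| <= 1.
Proof.
rewrite /unit_ball /= euclidean_norm_le1 => h.
rewrite -(ler_pXn2r (n := 2)) ?nnegrE ?normr_ge0 ?ler01 // expr1n real_normK ?num_real //.
apply: le_trans h; rewrite /dotprod (bigD1 i) //= -expr2 lerDl.
by apply: sumr_ge0 => j _; rewrite -expr2 sqr_ge0.
Qed.

Lemma dotprod_continuous (R : realType) (d : nat) (u : 'rV[R]_d) :
  continuous (dotprod u).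
Proof.
suff h (s : seq 'I_d) : continuous (fun x : 'rV[R]_d => \sum_(i <- s) u 0 i * x 0 i).
  exact: h.
elim: s => [|i s IH] x.
  under eq_fun do rewrite big_nil; apply: cst_continuous.
under eq_fun do rewrite big_cons.
apply: (@continuousD _ _ _ (fun x : 'rV[R]_d => u 0 i * x 0 i)); last exact: IH.
apply: (@continuousM _ _ (fun=> u 0 i)); first exact: cst_continuous.
exact: coord_continuous.
Qed.

Definition segment_convex (R : realType) (d : nat) (K : set 'rV[R]_d) : Prop :=
  forall (x y : 'rV[R]_d) (t : R), K x -> K y -> 0 <= t <= 1 ->
    K (x + t *: (y - x)).

(** [K] is the union of the segments from a fixed point [p] of it to its points. *)
Lemma convex_connected (R : realType) (d : nat) (K : set 'rV[R]_d) :
  segment_convex K -> connected K.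
Proof.
move=> cK; have [->|/set0P[p Kp]] := eqVneq K set0; first exact: connected0.
have -> : K = \bigcup_(q in K) ((fun t : R => p + t *: (q - p)) @` `[0, 1]).
  apply/seteqP; split=> [q Kq|_ [q Kq [t /= t01 <-]]].
    by exists q => //; exists 1; rewrite /= ?in_itv /= ?ler01 ?lexx // scale1r addrC subrK.
  by apply: cK => //; move: t01; rewrite in_itv.
apply: bigcup_connected.
  by exists p => q Kq; exists 0; rewrite /= ?in_itv /= ?ler01 ?lexx // scale0r addr0.
move=> q Kq; apply: connected_continuous_connected; first exact: segment_connected.
apply: continuous_subspaceT => t.
(* Continuity is checked entry by entry: a neighbourhood of a matrix contains a product of
   neighbourhoods of its entries. *)
move=> A [B hB BA].
suff : \forall s \near t, forall i j, B i j ((p + s *: (q - p)) i j).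
  by apply: filterS => s; exact: BA.
apply: (@filter_forall R _ _ (nbhs (t : R))) => i.
apply: (@filter_forall R _ _ (nbhs (t : R))) => j.
suff : (fun s : R => (p + s *: (q - p)) i j) @ t --> (p + t *: (q - p)) i j.
  by apply; exact: hB.
rewrite (_ : (fun _ => _) = fun s => p i j + s * (q - p) i j); last first.
  by apply/funext => s; rewrite !mxE.
rewrite !mxE; apply: cvgD; first exact: cvg_cst.
by apply: cvgM; [exact: cvg_id|exact: cvg_cst].
Qed.

(** The image of [K] under [dotprod u] is an interval that misses [[a, b]]. Applied to what a plank
    leaves uncovered, this puts the whole remainder on one side of the plank. *)
Lemma connected_one_side (R : realType) (d : nat) (K : set 'rV[R]_d)
    (u : 'rV[R]_d) (a b : R) :
  a <= b -> connected K -> (forall x, K x -> ~ (a <= dotprod u x <= b)) ->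
  (forall x, K x -> dotprod u x < a) \/ (forall x, K x -> b < dotprod u x).
Proof.
move=> ab cK hK.
have /connected_intervalP itv : connected (dotprod u @` K).
  apply: connected_continuous_connected => //.
  exact/continuous_subspaceT/dotprod_continuous.
have [[x [Kx xa]]|h] := pselect (exists x, K x /\ dotprod u x < a); last first.
  right=> x Kx; rewrite ltNge; apply/negP => xb; apply: (hK x Kx).
  by rewrite xb andbT leNgt; apply/negP => xa; apply: h; exists x.
left=> y Ky; rewrite ltNge; apply/negP => ay.
have [z Kz za] : (dotprod u @` K) a.
  by apply: (itv (dotprod u x) (dotprod u y)); [exists x|exists y|rewrite (ltW xa)].
by apply: (hK z Kz); rewrite za lexx.
Qed.

Lemma translate_plank (R : realType) (d : nat) (t u : 'rV[R]_d) (a b : R) :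
  translate t [set x | a <= dotprod u x <= b] =
  [set x | a + dotprod u t <= dotprod u x <= b + dotprod u t].
Proof.
apply/seteqP; split=> [_ /= [x h <-]|x /= h].
  by rewrite dotprodDr !lerD2r.
exists (x - t); last by rewrite subrK.
by rewrite /= dotprodBr lerBrDr lerBlDr.
Qed.

(** * Lower bound *)

(** [U j] is what the first [j] planks leave of [B], and [s j] tells on which side of plank [j] the
    remainder lies. The mean of four points of cap [j], pushed through plank [j], must have been
    covered by an earlier plank [i]. The four points lie beyond plank [i] but close to it, so the
    linear forms of [i] and [j] both vary little on them; on two points that share [x] or [y], the
    difference of the forms sees a single difference of slopes. *)
Lemma four_points_flat (R : realType) (f : nat) (al be m w : 'I_f -> R)
    (s : 'I_f -> bool) (B : R -> R -> R -> Prop) (eps delta : R)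
    (U := fun (j : nat) (x y z : R) => B x y z /\
       forall i : 'I_f, (i < j)%N -> ~ (`|z + al i * x + be i * y - m i| <= w i)) :
  (forall j, 0 <= w j <= eps) ->
  (forall (j : 'I_f) x y z, U j.+1 x y z ->
     if s j then m j + w j < z + al j * x + be j * y
     else z + al j * x + be j * y < m j - w j) ->
  (forall i j, i != j ->
     delta <= `|al i - al j| \/ delta <= `|be i - be j|) ->
  forall (j : 'I_f) (x y x1 x2 y1 y2 z1 z2 z3 z4 : R),
  let S := fun x y z => U j x y z /\ `|z + al j * x + be j * y - m j| <= w j in
  S x y1 z1 -> S x y2 z2 -> S x1 y z3 -> S x2 y z4 ->
  (forall e, `|e| <= 3 * eps -> B ((x + x + x1 + x2) / 4) ((y1 + y2 + y + y) / 4)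
       ((z1 + z2 + z3 + z4) / 4 + e)) ->
  0 < eps ->
  delta * `|y1 - y2| <= 20 * eps \/ delta * `|x1 - x2| <= 20 * eps.
Proof.
move=> hw hs sep j x y x1 x2 y1 y2 z1 z2 z3 z4 S [U1 S1] [U2 S2] [U3 S3] [U4 S4].
set mx := (_ / 4) => hB; set my := (_ / 4) in hB *; set mz := (_ / 4) in hB * => e0.
have /andP[w0 we] := hw j.
move: S1 S2 S3 S4; rewrite !ler_norml.
move=> /andP[a1 b1] /andP[a2 b2] /andP[a3 b3] /andP[a4 b4].
(* Moving the mean by [e] crosses plank [j] to the side opposite to the uncovered part. *)
pose e := if s j then - (3 * eps) else 3 * eps.
have Be : B mx my (mz + e).
  by apply: hB; rewrite /e; case: (s j); rewrite ?normrN ger0_norm ?mulr_ge0 // ltW.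
(* The shift [3 * eps] exceeds [2 * w j], so plank [j] misses the moved mean; with no earlier plank
   over it, it would be an uncovered point on the wrong side of plank [j]. *)
have [i ij Qi] : exists2 i : 'I_f, (i < j)%N &
    `|mz + e + al i * mx + be i * my - m i| <= w i.
  apply: contrapT => nex.
  have Uj : U j.+1 mx my (mz + e).
    split=> // i; rewrite ltnS leq_eqVlt => /orP[/eqP/val_inj ->|ij] Qi; last first.
      by apply: nex; exists i.
    move: Qi; rewrite ler_norml /e /mx /my /mz => /andP[].
    by case: (s j); lra.
  have := hs _ _ _ _ Uj; rewrite /e /mx /my /mz.
  by case: (s j); lra.
have /andP[wi0 wie] := hw i.
have sub x' y' z' : U j x' y' z' -> U i.+1 x' y' z'.
  by case=> ? h; split=> // k ki; apply: h; apply: leq_trans ij.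
move: (hs _ _ _ _ (sub _ _ _ U1)) (hs _ _ _ _ (sub _ _ _ U2))
      (hs _ _ _ _ (sub _ _ _ U3)) (hs _ _ _ _ (sub _ _ _ U4)).
move: Qi; rewrite ler_norml /e /mx /my /mz => /andP[c d].
have ne : i != j by rewrite -(inj_eq val_inj) neq_ltn ij.
(* The heights of the four points beyond plank [i] are positive with mean at most [3 * eps], so each
   is below [12 * eps], while form [j] varies by at most [2 * eps] on them. *)
have flat : s i = s j -> forall (h1 : if s i then
   [/\ m i + w i < z1 + al i * x + be i * y1, m i + w i < z2 + al i * x + be i * y2,
    m i + w i < z3 + al i * x1 + be i * y & m i + w i < z4 + al i * x2 + be i * y]
   else [/\ z1 + al i * x + be i * y1 < m i - w i, z2 + al i * x + be i * y2 < m i - w i,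
    z3 + al i * x1 + be i * y < m i - w i & z4 + al i * x2 + be i * y < m i - w i]),
   `|(be i - be j) * (y1 - y2)| <= 20 * eps /\ `|(al i - al j) * (x1 - x2)| <= 20 * eps.
  move=> sij; rewrite !ler_norml; move: c d; rewrite /e /mx /my /mz -sij.
  by case: (s i) => c d [h1 h2 h3 h4]; split; apply/andP; split; lra.
(* If the two sides differ, the push moves the mean further away from plank [i], which then cannot
   contain it. *)
case si : (s i) flat; case sj : (s j) c d => c d flat h1 h2 h3 h4; try lra.
all: have [//|f1 f2] := flat erefl; move: f1 f2; rewrite !normrM => f1 f2.
all: case: (sep _ _ ne) => h; [right; apply: le_trans f2|left; apply: le_trans f1].
all: exact: ler_wpM2r.
Qed.

Definition vec3 (R : realType) (x y z : R) : 'rV[R]_3 :=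
  \row_(i < 3) [:: x; y; z]`_i.

Lemma dotprod_vec3 (R : realType) (a b c x y z : R) :
  dotprod (vec3 a b c) (vec3 x y z) = a * x + b * y + c * z.
Proof. by rewrite /dotprod !big_ord_recl big_ord0 !mxE /= addr0 !addrA. Qed.

Lemma unit_ball_vec3 (R : realType) (x y z : R) :
  unit_ball (vec3 x y z) <-> x ^+ 2 + y ^+ 2 + z ^+ 2 <= 1.
Proof. by rewrite /unit_ball /= euclidean_norm_le1 dotprod_vec3 -!expr2. Qed.

Lemma first_cover (R : realType) (d f : nat) (K : set 'rV[R]_d)
    (P : 'I_f -> set 'rV[R]_d) (sigma : 'S_f) (x : 'rV[R]_d) :
  uncovered K P sigma f = set0 -> K x ->
  exists2 j : 'I_f, uncovered K P sigma j x & P (sigma j) x.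
Proof.
move=> h Kx.
have [j0 Pj0] : exists j : 'I_f, `[<P (sigma j) x>].
  apply: contrapT => nex; suff : uncovered K P sigma f x by rewrite h.
  by split=> // -[i /= _ Pi]; apply: nex; exists i; apply/asboolP.
case: (@arg_minnP _ j0 (fun j => `[<P (sigma j) x>]) (fun j => val j) Pj0) => j /asboolP Pj jmin.
exists j => //; split=> // -[i /= ij /asboolP Pi].
by have := jmin i Pi; rewrite leqNgt ij.
Qed.

(** * Counting grid points in caps *)

Lemma divn_modn_inj (N i j : nat) : (i %% N = j %% N)%N -> (i %/ N = j %/ N)%N -> i = j.
Proof. by move=> h1 h2; rewrite (divn_eq i N) h1 h2 -divn_eq. Qed.

Lemma ler_dist_nat (R : realType) (i j : nat) : i != j -> 1 <= `|i%:R - j%:R : R|.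
Proof.
rewrite neq_ltn => /orP[] ij; [rewrite distrC|]; rewrite -natrB 1?ltnW // normr_nat ler1n subn_gt0 //.
Qed.

Lemma modn_inj_close (D i j : nat) :
  (i < j + D)%N -> (j < i + D)%N -> (i %% D = j %% D)%N -> i = j.
Proof.
wlog ij : i j / (i <= j)%N.
  by move=> h a b c; case: (leqP i j) => [|/ltnW] ij; [apply: h|apply/esym/h].
move=> _ b /eqP; rewrite eq_sym eqn_mod_dvd // => dv.
have : (j - i < D)%N by rewrite ltn_subLR.
rewrite ltnNge; case: (posnP (j - i)) => [/eqP|p]; last by rewrite dvdn_leq.
by rewrite subn_eq0 => ji _; apply/eqP; rewrite eqn_leq ij.
Qed.

(** Each point of an [n * n * m] grid inside the ball is encoded by the plank that first covers it,
    one horizontal index in full, the other modulo [D], and the vertical index modulo 9. A cap is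
    short in one horizontal direction and short vertically, so the code is injective; one factor [n]
    then cancels. *)
Lemma lower_count (R : realType) (eps : R) (f N n m D : nat) :
  0 < eps -> eps <= 16^-1 -> (f <= N ^ 2)%N -> (0 < f)%N -> (0 < n)%N ->
  m%:R * eps <= 1 -> 80 * n%:R * N%:R * eps < D%:R ->
  always_covers 3 eps f -> (n * m <= f * D * 9)%N.
Proof.
move=> e0 e16 fN f0 n0 me hD cov.
have N0 : (0 < N)%N.
  by rewrite lt0n; apply: contraTneq f0 => N0; move: fN; rewrite N0 -leqNgt.
have NR : 0 < N%:R :> R by rewrite ltr0n.
(* The base-[N] digits of [i] give its slopes, so distinct planks differ by at least [1 / N] in one
   of them. *)
pose al (i : 'I_f) : R := (i %% N)%:R / N%:R.
pose be (i : 'I_f) : R := (i %/ N)%:R / N%:R.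
have al01 i : 0 <= al i <= 1.
  by rewrite divr_ge0 //= ler_pdivrMr // mul1r ler_nat ltnW // ltn_pmod.
have be01 i : 0 <= be i <= 1.
  rewrite divr_ge0 //= ler_pdivrMr // mul1r ler_nat ltnW //.
  by rewrite ltn_divLR // mulnn (leq_trans _ fN).
pose nu (i : 'I_f) : R := Num.sqrt (1 + al i ^+ 2 + be i ^+ 2).
have nu2 i : nu i ^+ 2 = 1 + al i ^+ 2 + be i ^+ 2.
  by rewrite sqr_sqrtr // -addrA addr_ge0 // addr_ge0 // sqr_ge0.
have nu12 i : 1 <= nu i <= 2.
  have ng : 0 <= nu i by exact: sqrtr_ge0.
  have /andP[p1 p2] := al01 i; have /andP[q1 q2] := be01 i.
  by have := nu2 i => nu2i; apply/andP; split; nra.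
have nu0 i : 0 < nu i by have := nu12 i; lra.
pose u (i : 'I_f) := vec3 (al i / nu i) (be i / nu i) (1 / nu i).
have [i|sigma [t [conn fin]]] := cov (fun i => [set x | 0 <= dotprod (u i) x <= 0 + eps]).
  exists (u i), 0; split=> //; apply/euclidean_norm_eq1; rewrite dotprod_vec3.
  have -> : al i / nu i * (al i / nu i) + be i / nu i * (be i / nu i) + 1 / nu i * (1 / nu i) =
    (1 + al i ^+ 2 + be i ^+ 2) / nu i ^+ 2 by field; rewrite gt_eqF.
  by rewrite -nu2 divff // expf_neq0 // gt_eqF.
set P' := (fun i : 'I_f => translate _ _) in conn fin.
pose c i := dotprod (u i) (t i).
have P'E i : P' i = [set x | c i <= dotprod (u i) x <= c i + eps].
  by rewrite /P' translate_plank /= !add0r addrC.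
(* Rescaling by [nu i] gives [z] the coefficient 1; as [nu i <= 2], the vertical half-width [w i] is
   at most [eps]. *)
pose mm i := nu i * (c i + eps / 2); pose w i := nu i * eps / 2.
have dotE i x y z : dotprod (u i) (vec3 x y z) = (z + al i * x + be i * y) / nu i.
  by rewrite dotprod_vec3; field; rewrite gt_eqF.
have P'v i x y z : P' i (vec3 x y z) <-> `|z + al i * x + be i * y - mm i| <= w i.
  rewrite ler_norml P'E /= dotE ler_pdivrMr // ler_pdivlMr // /mm /w.
  by split=> /andP[p q]; apply/andP; split; lra.
pose one_side (j : 'I_f) (b : bool) := forall x y z,
    unit_ball (vec3 x y z) /\ (forall i : 'I_f, (i < j.+1)%N ->
      ~ `|z + al (sigma i) * x + be (sigma i) * y - mm (sigma i)| <= w (sigma i)) ->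
    if b then mm (sigma j) + w (sigma j) < z + al (sigma j) * x + be (sigma j) * y
    else z + al (sigma j) * x + be (sigma j) * y < mm (sigma j) - w (sigma j).
have /boolp.choice[s hs] : forall j, exists b, one_side j b.
  move=> j.
  have Kout x : uncovered (@unit_ball R 3) P' sigma j.+1 x ->
      ~ (c (sigma j) <= dotprod (u (sigma j)) x <= c (sigma j) + eps).
    move=> [_ h] hx; suff Pj : P' (sigma j) x by apply: h; exists j => //=; exact: ltnSn.
    by rewrite P'E.
  have [||h|h] := connected_one_side _ _ Kout; first by rewrite lerDl ltW.
  - by apply: conn; rewrite /= ltn_ord.
  - exists false => x y z [Bx hx]; have /h : uncovered (@unit_ball R 3) P' sigma j.+1 (vec3 x y z).
      by split=> // -[i /= ij /P'v]; exact: hx.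
    rewrite dotE ltr_pdivrMr // /mm /w; lra.
  - exists true => x y z [Bx hx]; have /h : uncovered (@unit_ball R 3) P' sigma j.+1 (vec3 x y z).
      by split=> // -[i /= ij /P'v]; exact: hx.
    rewrite dotE ltr_pdivlMr // /mm /w; lra.
have sep i j : i != j -> N%:R^-1 <= `|al (sigma i) - al (sigma j)| \/
    N%:R^-1 <= `|be (sigma i) - be (sigma j)|.
  move=> ij; have ij' : sigma i != sigma j by rewrite (inj_eq perm_inj).
  have dN (p q : nat) : p != q -> N%:R^-1 <= `|p%:R / N%:R - q%:R / N%:R : R|.
    move=> pq; rewrite -mulrBl normrM [`|_^-1|]gtr0_norm ?invr_gt0 //.
    by rewrite ler_peMl ?invr_ge0 ?ler0n // ler_dist_nat.
  have [e|ne] := eqVneq (sigma i %% N)%N (sigma j %% N)%N; last by left; apply: dN.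
  right; apply: dN; apply: contraNneq ij' => e'.
  by apply/eqP/val_inj/(divn_modn_inj e e').
have wle i : 0 <= w (sigma i) <= eps.
  by have := nu12 (sigma i) => /andP[p q]; rewrite /w; apply/andP; split; nra.
have N'0 : 0 < N%:R^-1 :> R by rewrite invr_gt0.
have fp := four_points_flat wle hs sep.
have [->|m0] := posnP m; first by rewrite muln0.
(* Coordinates in [[0, 1/4]] leave room in the ball for a vertical shift by [3 * eps <= 3/16]. *)
pose X (i : 'I_n) : R := i%:R / (4 * n%:R).
pose Z (i : 'I_m) : R := i%:R / (4 * m%:R).
have nR : 0 < n%:R :> R by rewrite ltr0n.
have mR : 0 < m%:R :> R by rewrite ltr0n.
have X4 i : 0 <= X i <= 4^-1.
  rewrite /X divr_ge0 ?mulr_ge0 //= ler_pdivrMr ?mulr_gt0 // mulKf ?pnatr_eq0 //.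
  by rewrite ler_nat ltnW.
have Z4 i : 0 <= Z i <= 4^-1.
  rewrite /Z divr_ge0 ?mulr_ge0 //= ler_pdivrMr ?mulr_gt0 // mulKf ?pnatr_eq0 //.
  by rewrite ler_nat ltnW.
have ballv x y z : 0 <= x <= 4^-1 -> 0 <= y <= 4^-1 -> - 2^-1 <= z <= 2^-1 -> unit_ball (vec3 x y z).
  move=> /andP[? ?] /andP[? ?] /andP[? ?]; apply/unit_ball_vec3; nra.
pose T := ('I_n * 'I_n * 'I_m)%type.
pose pt (p : T) := vec3 (X p.1.1) (X p.1.2) (Z p.2).
have /boolp.choice[j hj] : forall p, exists j : 'I_f,
    uncovered (@unit_ball R 3) P' sigma j (pt p) /\ P' (sigma j) (pt p).
  move=> p; have [|j Uj Pj] := first_cover (x := pt p) fin; last by exists j.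
  by apply: ballv => //; have := Z4 p.2; lra.
pose L k x y z : R := z + al (sigma k) * x + be (sigma k) * y - mm (sigma k).
have inS p : (unit_ball (vec3 (X p.1.1) (X p.1.2) (Z p.2)) /\ (forall i : 'I_f, (i < j p)%N ->
      ~ `|L i (X p.1.1) (X p.1.2) (Z p.2)| <= w (sigma i))) /\
    `|L (j p) (X p.1.1) (X p.1.2) (Z p.2)| <= w (sigma (j p)).
  have [[Bp hp] Pp] := hj p; split; last exact/P'v.
  by split=> // i ij /P'v Pi; apply: hp; exists i.
have D0 : (0 < D)%N.
  by rewrite -(ltr0n R); apply: le_lt_trans hD; rewrite !mulr_ge0 // ltW.
have farX (a b : 'I_n) : (a + D <= b)%N -> 20 * eps < N%:R^-1 * `|X a - X b|.
  move=> ab; rewrite distrC ger0_norm; last first.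
    rewrite subr_ge0 /X ler_pM2r ?invr_gt0 ?mulr_gt0 // ler_nat.
    by apply: leq_trans ab; rewrite leq_addr.
  have abR : a%:R + D%:R <= b%:R :> R by rewrite -natrD ler_nat.
  rewrite [ltRHS]mulrC ltr_pdivlMr // /X -mulrBl ltr_pdivlMr ?mulr_gt0 //.
  by lra.
have avg (a b c' d : R) : 0 <= a <= 4^-1 -> 0 <= b <= 4^-1 -> 0 <= c' <= 4^-1 ->
    0 <= d <= 4^-1 -> 0 <= (a + b + c' + d) / 4 <= 4^-1.
  by move=> *; lra.
have noboth (p q p' q' : T) k : j p = k -> j q = k -> j p' = k -> j q' = k ->
    p.1.1 = q.1.1 -> (p.1.2 + D <= q.1.2)%N ->
    p'.1.2 = q'.1.2 -> (p'.1.1 + D <= q'.1.1)%N -> False.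
  move=> jp jq jp' jq' pq /farX pqD pq' /farX pqD'.
  have Sp := inS p; have Sq := inS q; have Sp' := inS p'; have Sq' := inS q'.
  rewrite jp in Sp; rewrite jq -pq in Sq; rewrite jp' in Sp'; rewrite jq' -pq' in Sq'.
  have [|h|h] := fp k _ _ _ _ _ _ _ _ _ _ Sp Sq Sp' Sq' _ e0.
  - move=> e; rewrite ler_norml => /andP[eb ea].
    have /andP[z0 z4] := avg _ _ _ _ (Z4 p.2) (Z4 q.2) (Z4 p'.2) (Z4 q'.2).
    apply: ballv; [exact: avg|exact: avg|].
    by apply/andP; split; lra.
  - by move: h; rewrite leNgt pqD.
  - by move: h; rewrite leNgt pqD'.
(* A cap meets a vertical line in length at most [2 * eps], which is at most 8 grid steps because
   [m * eps <= 1]. *)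
have closeZ (p q : T) : j p = j q -> p.1 = q.1 -> (p.2 < q.2 + 9)%N.
  move=> jpq pq; have [_ Lp] := inS p; have [_ Lq] := inS q.
  move: Lp Lq; rewrite /L jpq pq !ler_norml => /andP[_ ha] /andP[hb _].
  have /andP[_ we] := wle (j q).
  have : Z p.2 - Z q.2 <= 2 * eps by lra.
  rewrite /Z -mulrBl ler_pdivrMr ?mulr_gt0 // => h.
  rewrite -(ltr_nat R) natrD.
  by nra.
(* [sw k] records a pair in cap [k] that shares [x] and is far apart in [y]. By [noboth] the cap is
   then short along lines of constant [y]; without such a pair it is short along lines of constant
   [x]. *)
pose sw k := `[< exists p q : T, [/\ j p = k, j q = k, p.1.1 = q.1.1 & (p.1.2 + D <= q.1.2)%N] >].
have swT (p q : T) : j p = j q -> p.1.2 = q.1.2 -> sw (j p) -> (p.1.1 < q.1.1 + D)%N.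
  move=> jpq pq /asboolP[p' [q' [jp jq e1 e2]]]; rewrite ltnNge; apply/negP => h.
  exact: (noboth p' q' q p (j p)).
have swF (p q : T) : j p = j q -> p.1.1 = q.1.1 -> ~~ sw (j p) -> (p.1.2 < q.1.2 + D)%N.
  move=> jpq pq /asboolP nex; rewrite ltnNge; apply/negP => h; apply: nex.
  by exists q, p.
pose g (p : T) : 'I_f * 'I_n * 'I_D * 'I_9 :=
  (j p, if sw (j p) then p.1.2 else p.1.1,
   Ordinal (ltn_pmod (if sw (j p) then p.1.1 else p.1.2) D0),
   Ordinal (ltn_pmod p.2 (isT : 0 < 9)%N)).
have ginj : injective g.
  move=> p q [jpq]; rewrite -jpq => h1 h2 h3.
  have pq1 : p.1 = q.1.
    case: (boolP (sw (j p))) h1 h2 => sj h1 h2.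
      rewrite [p.1]surjective_pairing [q.1]surjective_pairing h1; congr (_, _).
      by apply/val_inj/(modn_inj_close _ _ h2); apply: swT; rewrite -?jpq.
    rewrite [p.1]surjective_pairing [q.1]surjective_pairing h1; congr (_, _).
    by apply/val_inj/(modn_inj_close _ _ h2); apply: swF; rewrite -?jpq.
  rewrite [p]surjective_pairing [q]surjective_pairing pq1; congr (_, _).
  by apply/val_inj/(modn_inj_close _ _ h3); apply: closeZ.
have := leq_card g ginj; rewrite !card_prod !card_ord => h.
rewrite -(leq_pmul2l n0) mulnA (leq_trans h) //.
by rewrite leq_eqVlt; apply/orP; left; apply/eqP; ring.
Qed.

(** For width [d ^+ 3], take [N] of order [d ^- 2], [n] of order [d^-1] and [m] of order [d ^- 3];
    then [D] is a constant and [n * m] is of order [d ^- 4]. *)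
Lemma lower_bound_cube (R : realType) (d : R) (f : nat) :
  0 < d -> d < 1 -> (0 < f)%N -> always_covers 3 (d ^+ 3) f ->
  10000^-1 * (d ^+ 4)^-1 <= f%:R.
Proof.
move=> d0 d1 f0 cov.
have fR : 1 <= f%:R :> R by rewrite ler1n.
have d4 : 0 < d ^+ 4 by rewrite exprn_gt0.
rewrite ler_pdivrMr //.
(* For large width, [d ^+ 4] is at least [1/256] and [1 <= f] suffices. *)
have [big|small] := ltrP 16^-1 (d ^+ 3).
  have h1 : 16^-1 < d.
    by apply: lt_le_trans big _; rewrite -[leRHS]expr1 ler_wiXn2l // ltW.
  have : 16^-1 * 16^-1 <= d ^+ 4.
    by rewrite [d ^+ 4]exprS ler_pM ?ltW.
  by nra.
pose N := (Num.truncn (d ^- 2)).+1.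
have d2 : 0 < d ^- 2 by rewrite invr_gt0 exprn_gt0.
have /truncn_itv/andP[N1 N2] := ltW d2.
pose n := Num.truncn d^-1; pose m := Num.truncn (d ^- 3).
have di : 1 < d^-1 by rewrite invf_gt1.
have /truncn_itv/andP[n1 n2] : 0 <= d^-1 by lra.
have d3 : 0 < d ^- 3 by rewrite invr_gt0 exprn_gt0.
have /truncn_itv/andP[m1 m2] := ltW d3.
rewrite -/n in n1 n2; rewrite -/m in m1 m2; rewrite -/N in N2.
have n0 : (0 < n)%N by rewrite -ltnS -(ltr_nat R) (lt_trans di).
have dd k : d ^+ k * d ^- k = 1 by rewrite divff // expf_neq0 // gt_eqF.
(* More than [N ^ 2] planks are already more than [d ^- 4]. *)
have [fN|fN] := leqP f (N ^ 2); last first.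
  have : N%:R ^+ 2 <= f%:R :> R by rewrite -natrX ler_nat ltnW.
  have : d ^- 2 * d ^- 2 <= N%:R ^+ 2 by rewrite expr2 ler_pM // ltW.
  move=> h1 h2; have := ler_wpM2r (ltW d4) (le_trans h1 h2).
  have -> : d ^- 2 * d ^- 2 * d ^+ 4 = 1 by field; rewrite gt_eqF.
  lra.
have hm : m%:R * d ^+ 3 <= 1.
  by have := ler_wpM2r (exprn_ge0 3 (ltW d0)) m1; rewrite mulVf // expf_neq0 // gt_eqF.
(* Here [n * N * d ^+ 3 <= 2], which bounds the left side by 160. *)
have hD : 80 * n%:R * N%:R * d ^+ 3 < 161%:R.
  have Nle : N%:R <= 2 * d ^- 2.
    rewrite /N -natr1; have : 1 <= d ^- 2 by rewrite invf_ge1 ?exprn_gt0 // exprn_ile1 // ltW.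
    lra.
  have : n%:R * N%:R <= d^-1 * (2 * d ^- 2) by rewrite ler_pM.
  move=> /(ler_wpM2r (exprn_ge0 3 (ltW d0))).
  have -> : d^-1 * (2 * d ^- 2) * d ^+ 3 = 2 by field; rewrite gt_eqF.
  by rewrite -!mulrA; lra.
have := lower_count (exprn_gt0 3 d0) small fN f0 n0 hm hD cov.
rewrite -(ler_nat R) !natrM => h.
have nge : d^-1 <= 2 * n%:R.
  have : 1 <= n%:R :> R by rewrite ler1n.
  by move: n2; rewrite -natr1; lra.
have d31 : 1 <= d ^- 3 by rewrite invf_ge1 ?exprn_gt0 // exprn_ile1 // ltW.
have m0 : (0 < m)%N by rewrite -ltnS -(ltr_nat R) (le_lt_trans d31).
have mge : d ^- 3 <= 2 * m%:R.
  have : 1 <= m%:R :> R by rewrite ler1n.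
  by move: m2; rewrite -natr1; lra.
have : d^-1 * d ^- 3 <= (2 * n%:R) * (2 * m%:R) by rewrite ler_pM // ltW // invr_gt0.
have -> : d^-1 * d ^- 3 = d ^- 4 by field; rewrite gt_eqF.
move=> h'; have := ler_wpM2l (ltW d4) h'; rewrite dd => h''.
have := ler_wpM2l (ltW d4) h; lra.
Qed.

(** * Upper bound *)

(** It sees [K] only through its projection to the plane with coordinates [x 0 i0 + a * x 0 i1] and
    [x 0 i2]; [i0] will be the dominant coordinate of the normals. *)
Definition slope_sup (R : realType) (i0 i1 i2 : 'I_3) (K : set 'rV[R]_3) (a : R)
    (phi : R -> R) : R :=
  sup [set x 0 i0 + a * x 0 i1 + phi (x 0 i2) | x in K].

Definition grid (R : realType) (N : nat) (k : 'I_(2 * N).+1) : R :=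
  -1 + k%:R / N%:R.

(* [probe (k, true)] gives the support function of the projection in a direction
   of slope [grid k]; [probe (k, false)] gives the height of its upper boundary
   above [grid k], regularized to be Lipschitz. *)
Definition probe (R : realType) (N : nat) (k : 'I_(2 * N).+1 * bool) (y : R) : R :=
  if k.2 then grid R k.1 * y else - (2 * `|y - grid R k.1|).

(* Subtracting [a] makes the potential nonincreasing in [a]. *)
Definition potential (R : realType) (i0 i1 i2 : 'I_3) (N : nat)
    (K : set 'rV[R]_3) (a : R) : R :=
  \sum_(k : 'I_(2 * N).+1 * bool) (slope_sup i0 i1 i2 K a (probe k) - a).

(** This is what remains once a plank with normal [u] has its upper face supporting [K]; the
    inequality is strict because planks are closed. *)
Definition shave (R : realType) (d : nat) (eps : R) (K : set 'rV[R]_d)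
    (u : 'rV[R]_d) : set 'rV[R]_d :=
  K `&` [set x | dotprod u x < sup (dotprod u @` K) - eps].

(** * The grid of slopes and the probes *)

Section Grid.
Variables (R : realType) (N : nat).
Hypothesis N0 : (0 < N)%N.

Let NR : 0 < N%:R :> R. Proof. by rewrite ltr0n. Qed.

Lemma grid_bound (k : 'I_(2 * N).+1) : `|grid R k| <= 1.
Proof.
have : (k%:R / N%:R : R) <= 2.
  by rewrite ler_pdivrMr // -natrM ler_nat -ltnS ltn_ord.
have : 0 <= (k%:R / N%:R : R) by rewrite divr_ge0.
by rewrite /grid ler_norml; lra.
Qed.

Lemma grid_floor (y : R) : `|y| <= 1 ->
  exists k : 'I_(2 * N).+1, grid R k <= y < grid R k + N%:R^-1.
Proof.
rewrite ler_norml => /andP[y1 y2].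
have /truncn_itv : 0 <= (y + 1) * N%:R by rewrite mulr_ge0 // -lerBlDr sub0r.
set m := Num.truncn _ => /andP[m1 m2].
have lm : (m < (2 * N).+1)%N.
  rewrite ltnS -(ler_nat R) (le_trans m1) // natrM ler_pM2r //.
  by lra.
exists (Ordinal lm); rewrite /grid /=.
have h1 : m%:R / N%:R <= y + 1 by rewrite ler_pdivrMr.
have h2 : y + 1 < m.+1%:R / N%:R by rewrite ltr_pdivlMr.
by move: h2; rewrite -natr1 mulrDl mul1r => h2; apply/andP; split; lra.
Qed.

Lemma grid_ceil (y : R) : `|y| <= 1 ->
  exists k : 'I_(2 * N).+1, y <= grid R k <= y + N%:R^-1.
Proof.
rewrite -normrN => /grid_floor[k /andP[k1 k2]]; exists (rev_ord k).
have -> : grid R (rev_ord k) = - grid R k.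
  rewrite /grid /= subSS natrB -1?ltnS // natrM; field.
  by rewrite gt_eqF.
by apply/andP; split; lra.
Qed.

Lemma probe_bound (k : 'I_(2 * N).+1 * bool) (y : R) : `|y| <= 1 -> `|probe k y| <= 4.
Proof.
move=> y1; have g1 := grid_bound k.1; rewrite /probe; case: k.2.
  rewrite normrM; apply: (@le_trans _ _ 1); last by lra.
  by rewrite mulr_ile1.
rewrite normrN normrM normr_id ger0_norm //.
have := ler_normB y (grid R k.1); lra.
Qed.

End Grid.

(** * The potential and its decrease *)

Section Potential.
Variables (R : realType) (i0 i1 i2 : 'I_3).
Implicit Types (K : set 'rV[R]_3) (a : R).

Local Notation slope_sup := (@slope_sup R i0 i1 i2).
Local Notation potential := (@potential R i0 i1 i2).

Lemma slope_sup_ub K a phi (x : 'rV[R]_3) :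
  K `<=` @unit_ball R 3 -> `|a| <= 1 -> (forall y, `|y| <= 1 -> `|phi y| <= 4) ->
  K x -> x 0 i0 + a * x 0 i1 + phi (x 0 i2) <= slope_sup K a phi.
Proof.
move=> KB a1 phi4 Kx; apply: ub_le_sup; last by exists x.
exists 6 => _ [y /KB By <-].
have h0 := unit_ball_coord i0 By; have h1 := unit_ball_coord i1 By.
have h2 := phi4 _ (unit_ball_coord i2 By).
have : `|a * y 0 i1| <= 1 by rewrite normrM mulr_ile1.
by move: h0 h2; rewrite !ler_norml; lra.
Qed.

Lemma slope_sup_le K a phi c :
  K !=set0 -> (forall x, K x -> x 0 i0 + a * x 0 i1 + phi (x 0 i2) <= c) ->
  slope_sup K a phi <= c.
Proof.
by move=> [x Kx] h; apply: ge_sup => [|_ [y Ky <-]]; [eexists; exists x|exact: h].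
Qed.

Lemma slope_sup_bound K a phi : K !=set0 ->
  K `<=` @unit_ball R 3 -> `|a| <= 1 -> (forall y, `|y| <= 1 -> `|phi y| <= 4) ->
  `|slope_sup K a phi| <= 6.
Proof.
move=> K0 KB a1 phi4.
have h y : K y -> `|y 0 i0 + a * y 0 i1 + phi (y 0 i2)| <= 6.
  move=> /KB By.
  have h0 := unit_ball_coord i0 By; have h1 := unit_ball_coord i1 By.
  have h2 := phi4 _ (unit_ball_coord i2 By).
  have : `|a * y 0 i1| <= 1 by rewrite normrM mulr_ile1.
  by move: h0 h2; rewrite !ler_norml; lra.
rewrite ler_norml; apply/andP; split; last first.
  by apply: slope_sup_le => // x /h; rewrite ler_norml => /andP[].
case: K0 => x Kx; apply: le_trans (slope_sup_ub KB a1 phi4 Kx).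
by have := h _ Kx; rewrite ler_norml => /andP[].
Qed.

Lemma slope_sup_subset K K' a phi : K' !=set0 -> K' `<=` K ->
  K `<=` @unit_ball R 3 -> `|a| <= 1 -> (forall y, `|y| <= 1 -> `|phi y| <= 4) ->
  slope_sup K' a phi <= slope_sup K a phi.
Proof.
move=> K0 KK KB a1 phi4; apply: slope_sup_le => // x /KK Kx.
exact: slope_sup_ub.
Qed.

(** The coefficient of [a] is a coordinate of a point of the ball, hence at most 1, so the supremum
    grows no faster than [a]. *)
Lemma slope_sup_tilt K a a' phi : K !=set0 ->
  K `<=` @unit_ball R 3 -> `|a| <= 1 -> (forall y, `|y| <= 1 -> `|phi y| <= 4) ->
  a <= a' -> slope_sup K a' phi - a' <= slope_sup K a phi - a.
Proof.
move=> K0 KB a1 phi4 aa'; rewrite lerBlDr; apply: slope_sup_le => // x Kx.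
have := slope_sup_ub KB a1 phi4 Kx; have := unit_ball_coord i1 (KB _ Kx).
rewrite ler_norml => /andP[x1 x2].
have : (a' - a) * x 0 i1 <= a' - a by rewrite ler_piMr // subr_ge0.
lra.
Qed.

(** Either the support function at the grid slope just below [b] drops, or [K] contains a long
    segment that descends slowly from near its top; a grid value of [x 0 i2] is then reached on it
    while still high, and the upper boundary drops there. *)
Lemma shave_drop N K (u : 'rV[R]_3) (eps a b : R) : (0 < N)%N ->
  4 <= eps * N%:R ^+ 2 -> 0 < eps ->
  segment_convex K -> K `<=` @unit_ball R 3 -> `|a| <= 1 -> `|b| <= 1 ->
  0 < u 0 i0 <= 1 ->
  (forall x, dotprod u x = u 0 i0 * (x 0 i0 + a * x 0 i1 + b * x 0 i2)) ->
  shave eps K u !=set0 ->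
  exists k : 'I_(2 * N).+1 * bool,
    slope_sup (shave eps K u) a (probe k) <= slope_sup K a (probe k) - eps / 4.
Proof.
move=> N0 eN e0 cK KB a1 b1 /andP[u0 u1] uE K'0.
pose lv (x : 'rV[R]_3) := x 0 i0 + a * x 0 i1 + b * x 0 i2.
pose H := sup (dotprod u @` K) / u 0 i0.
have NR : 0 < N%:R :> R by rewrite ltr0n.
have K0 : K !=set0 by case: K'0 => x [Kx _]; exists x.
have K'K : shave eps K u `<=` K by move=> x [].
have K'B := subset_trans K'K KB.
have hub : has_ubound (dotprod u @` K).
  exists (u 0 i0 * 3) => _ [x /KB Bx <-]; rewrite uE ler_pM2l //.
  have h0 := unit_ball_coord i0 Bx; have h1 := unit_ball_coord i1 Bx.
  have h2 := unit_ball_coord i2 Bx.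
  have : `|a * x 0 i1| <= 1 by rewrite normrM mulr_ile1.
  have : `|b * x 0 i2| <= 1 by rewrite normrM mulr_ile1.
  by move: h0; rewrite !ler_norml; lra.
have lvH x : K x -> lv x <= H.
  by move=> Kx; rewrite ler_pdivlMr // mulrC -uE; apply: ub_le_sup => //; exists x.
(* As [u 0 i0 <= 1], depth [eps] along [u] is at least [eps] when measured by [lv]. *)
have lvH' x : shave eps K u x -> lv x < H - eps.
  move=> [_]; rewrite /= uE -/(lv x) => h.
  have : eps <= eps / u 0 i0 by rewrite ler_pdivlMr // ler_piMr // ltW.
  have : lv x < H - eps / u 0 i0 by rewrite /H -mulrBl ltr_pdivlMr // mulrC.
  by lra.
have [p Kp lvp] : exists2 p, K p & H - eps / 8 < lv p.
  have [_ [p Kp <-] hp] : exists2 y, (dotprod u @` K) y & sup (dotprod u @` K) - u 0 i0 * (eps / 8) < y.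
    apply: sup_adherent; first by rewrite mulr_gt0 // divr_gt0.
    by split=> //; case: K0 => x Kx; eexists; exists x.
  exists p => //; rewrite ltrBlDr ltr_pdivrMr // mulrDl.
  by move: hp; rewrite uE /lv; lra.
have /(grid_floor N0)[k /andP[kb bk]] := b1.
have [drop|nodrop] := lerP (slope_sup (shave eps K u) a (probe (k, true)))
   (slope_sup K a (probe (k, true)) - eps / 4).
  by exists (k, true).
(* The support function in the direction nearest to [u] barely drops, so the
   chord is long: the segment [p q] stays near the top of [K] over a whole
   grid step. *)
have [q K'q hq] : exists2 q, shave eps K u q &
    slope_sup K a (probe (k, true)) - eps / 4 < q 0 i0 + a * q 0 i1 + probe (k, true) (q 0 i2).
  have [|_ [q Kq <-] hq] := sup_gt _ nodrop; last by exists q.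
  by case: K'0 => x Kx; eexists; exists x.
have /lvH' lvq := K'q; have Kq := K'K _ K'q.
have hp := slope_sup_ub KB a1 (probe_bound (R := R) N0 (k, true)) Kp.
have Bp := unit_ball_coord i2 (KB _ Kp); have Bq := unit_ball_coord i2 (KB _ Kq).
set eta := N%:R^-1 in bk.
have eta0 : 0 < eta by rewrite invr_gt0.
have eta2 : 4 * eta ^+ 2 <= eps.
  by rewrite /eta exprVn ler_pdivrMr ?exprn_gt0.
pose yp := p 0 i2; pose yq := q 0 i2; pose D := lv p - lv q.
have D1 : D < (grid R k - b) * (yq - yp) + eps / 4.
  by move: hp hq; rewrite /probe /= /D /lv /yq /yp; lra.
have D2 : 7 / 8 * eps < D by rewrite /D; lra.
have D3 : (grid R k - b) * (yq - yp) <= eta * `|yq - yp|.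
  apply: le_trans (ler_norm _) _; rewrite normrM ler_wpM2r // ler_norml.
  by apply/andP; split; lra.
(* By [D2], [eps / 4] is at most [2/7 * D]; the slope error over the segment accounts for the rest
   of [D]. *)
have D4 : 5 * D <= 7 * (eta * `|yq - yp|) by lra.
have [t [ht tpq]] : exists t : 'I_(2 * N).+1, `|grid R t - yp| <= eta /\
    0 <= (grid R t - yp) * (yq - yp).
  have [le|lt] := lerP yp yq.
    have [t] := grid_ceil N0 Bp; rewrite -/eta -/yp => /andP[t1 t2]; exists t; split.
      by rewrite ler_norml; apply/andP; split; lra.
    by rewrite mulr_ge0 // subr_ge0.
  have [t] := grid_floor N0 Bp; rewrite -/eta -/yp => /andP[t1 t2]; exists t; split.
    by rewrite ler_norml; apply/andP; split; lra.
  by rewrite mulr_le0 // subr_le0 // ltW.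
pose W := `|yq - yp|.
have W0 : 0 <= W by exact: normr_ge0.
have etaW : eta <= W by move: D4; rewrite -/W => D4; nra.
have Wgt0 : 0 < W by lra.
pose tau := `|grid R t - yp| / W.
have tau01 : 0 <= tau <= 1.
  by rewrite divr_ge0 //= ler_pdivrMr // mul1r (le_trans ht).
have tauE : tau * (yq - yp) = grid R t - yp.
  rewrite /tau /W; case: (lerP 0 (yq - yp)) tpq Wgt0 => h; rewrite /W.
    rewrite (ger0_norm h) => tpq h'; rewrite ger0_norm ?divfK ?gt_eqF //.
    by move: tpq; rewrite pmulr_lge0.
  rewrite (ltr0_norm h) => tpq h'; rewrite ler0_norm; last by move: tpq; rewrite nmulr_lge0.
  by rewrite invrN mulrNN divfK ?lt_eqF.
(* Up to the grid value the segment descends by at most [7/5 * eta ^+ 2 <= 7/20 * eps]. *)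
have tauD : tau * D <= 3 / 8 * eps.
  have : tau * (5 * D) <= tau * (7 * (eta * W)) by rewrite ler_wpM2l //; case/andP: tau01.
  have : tau * W <= eta by rewrite /tau divfK ?gt_eqF.
  nra.
pose r := p + tau *: (q - p).
have Kr : K r by apply: cK.
have r2 : r 0 i2 = grid R t by rewrite !mxE -/yp -/yq tauE; ring.
have lvr : lv r = lv p - tau * D by rewrite /lv /D /lv !mxE; ring.
have Br := slope_sup_ub KB a1 (probe_bound (R := R) N0 (t, false)) Kr.
(* As [|b| <= 1], the slope 2 of the penalty outweighs the tilt [b], so the shaved body stays below
   this value, while [r] puts [K] more than [eps / 2] above it. *)
exists (t, false); apply: (@le_trans _ _ (H - eps - b * grid R t)).
  apply: slope_sup_le => // x K'x; have := lvH' x K'x; rewrite /lv /probe /=.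
  have : b * (grid R t - x 0 i2) <= `|x 0 i2 - grid R t|.
    by rewrite (le_trans (ler_norm _)) // normrM distrC ler_piMl.
  have := normr_ge0 (x 0 i2 - grid R t); lra.
have lvrE : lv r = r 0 i0 + a * r 0 i1 + b * grid R t by rewrite /lv r2.
have pr : probe (t, false) (r 0 i2) = 0 :> R.
  by rewrite /probe /= r2 subrr normr0 mulr0 oppr0.
rewrite pr in Br.
by lra.
Qed.

Definition good_normal (u : 'rV[R]_3) : Prop :=
  [/\ euclidean_norm u = 1, 0 < u 0 i0, `|u 0 i1| <= u 0 i0 & `|u 0 i2| <= u 0 i0].

Definition slope (u : 'rV[R]_3) : R := u 0 i1 / u 0 i0.

Lemma shave_subset d eps (K : set 'rV[R]_d) u : shave eps K u `<=` K.
Proof. by move=> x []. Qed.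

Lemma shave_convex d eps (K : set 'rV[R]_d) u :
  segment_convex K -> segment_convex (shave eps K u).
Proof.
move=> cK x y t [Kx /= hx] [Ky /= hy] t01; split; first exact: cK.
move: t01 => /andP[t0 t1]; rewrite /= dotprodDr dotprodZr dotprodBr.
move: hx hy; set s := _ - eps => hx hy.
have hy' : 0 <= t * (s - dotprod u y) by rewrite mulr_ge0 // subr_ge0 ltW.
have hx' : 0 <= (1 - t) * (s - dotprod u x) by rewrite mulr_ge0 // subr_ge0 // ltW.
have [h|h] := lerP t 2^-1.
  have : 0 < (1 - t) * (s - dotprod u x) by rewrite mulr_gt0 // subr_gt0 //; lra.
  by lra.
have : 0 < t * (s - dotprod u y) by rewrite mulr_gt0 // ?subr_gt0 //; lra.
by lra.
Qed.

Definition shaves d eps (K : set 'rV[R]_d) (us : seq 'rV[R]_d) : set 'rV[R]_d :=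
  foldl (shave eps) K us.

Lemma shaves_subset d eps (K : set 'rV[R]_d) us : shaves eps K us `<=` K.
Proof.
elim: us K => [|u us IH] K; first exact: subset_refl.
exact: subset_trans (IH _) (@shave_subset _ _ _ _).
Qed.

(** Before each shave [a] is raised to the slope of the next normal, which the sorting allows and
    which cannot increase the potential; the shave then lowers one summand by [eps / 4] and raises
    none. The hypothesis on [dotprod] makes [i0], [i1], [i2] an enumeration of the coordinates. *)
Lemma potential_shaves N (eps : R) (us : seq 'rV[R]_3) K a : (0 < N)%N ->
  4 <= eps * N%:R ^+ 2 -> 0 < eps ->
  (forall x : 'rV[R]_3, forall u, dotprod u x = u 0 i0 * x 0 i0 + u 0 i1 * x 0 i1 + u 0 i2 * x 0 i2) ->
  segment_convex K -> K `<=` @unit_ball R 3 -> `|a| <= 1 ->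
  (forall u, u \in us -> good_normal u) ->
  path (fun a b => a <= b) a (map slope us) ->
  shaves eps K us !=set0 ->
  potential N (shaves eps K us) 1 + (size us)%:R * (eps / 4) <= potential N K a.
Proof.
move=> N0 eN e0 dE.
have pb := probe_bound (R := R) N0.
have mono K' b b' : K' !=set0 -> K' `<=` @unit_ball R 3 -> `|b| <= 1 -> b <= b' ->
    potential N K' b' <= potential N K' b.
  move=> K0 KB b1 bb'; apply: ler_sum => k _; exact: slope_sup_tilt (pb k) bb'.
elim: us K a => [|u us IH] K a cK KB a1 gus /=.
  move=> _ K0; rewrite mul0r addr0; apply: mono => //.
  by move: a1; rewrite ler_norml => /andP[].
move=> /andP[aa pus] Ks0.
have K'0 : shave eps K u !=set0 by case: Ks0 => x /shaves_subset; exists x.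
have K0 : K !=set0 by case: K'0 => x /shave_subset; exists x.
have [u1 u0 hi1 hi2] := gus u (mem_head _ _).
have sl1 : `|slope u| <= 1.
  by rewrite /slope normrM normfV (gtr0_norm u0) ler_pdivrMr // mul1r.
have sl2 : `|u 0 i2 / u 0 i0| <= 1.
  by rewrite normrM normfV (gtr0_norm u0) ler_pdivrMr // mul1r.
have gus' v : v \in us -> good_normal v by move=> h; apply: gus; rewrite in_cons h orbT.
have {}IH := IH _ _ (shave_convex cK) (subset_trans (@shave_subset _ _ _ _) KB) sl1 gus' pus Ks0.
have step : potential N (shave eps K u) (slope u) + eps / 4 <= potential N K (slope u).
  have u01 : 0 < u 0 i0 <= 1.
    rewrite u0 /=; apply: le_trans (ler_norm _) _; apply: unit_ball_coord.
    by rewrite /unit_ball /= u1.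
  have uE x : dotprod u x =
      u 0 i0 * (x 0 i0 + slope u * x 0 i1 + u 0 i2 / u 0 i0 * x 0 i2).
    by rewrite dE /slope; field; rewrite gt_eqF.
  have [k hk] := shave_drop N0 eN e0 cK KB sl1 sl2 u01 uE K'0.
  rewrite /potential (bigD1 k) //= [leRHS](bigD1 k) //=.
  rewrite -addrA [_ + eps / 4]addrC addrA lerD //; first by lra.
  apply: ler_sum => k' _; rewrite lerD2r.
  exact: slope_sup_subset K'0 (@shave_subset _ _ _ _) KB sl1 (pb k').
have := mono K a (slope u) K0 KB a1 aa.
rewrite -natr1 mulrDl mul1r; move: IH; rewrite /shaves; lra.
Qed.

Lemma potential_bound N K a : (0 < N)%N -> K !=set0 -> K `<=` @unit_ball R 3 ->
  `|a| <= 1 -> `|potential N K a| <= (14 * (2 * N).+1)%:R.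
Proof.
move=> N0 K0 KB a1; apply: le_trans (ler_norm_sum _ _ _) _.
apply: (@le_trans _ _ (\sum_(k : 'I_(2 * N).+1 * bool) 7)).
  apply: ler_sum => k _; apply: le_trans (ler_normB _ _) _.
  have := slope_sup_bound K0 KB a1 (probe_bound (R := R) N0 k).
  lra.
rewrite sumr_const card_prod card_ord card_bool -[7 *+ _]mulr_natr -natrM ler_nat.
by rewrite [(_ * 2)%N]mulnC mulnA.
Qed.

(** While the body is nonempty, the potential stays within [14 * (2 * N).+1] of 0, so drops of
    [eps / 4] add up to at most [28 * (2 * N).+1]; hence the constant 112. *)
Lemma shaves_exhaust N (eps : R) (us : seq 'rV[R]_3) : (0 < N)%N ->
  4 <= eps * N%:R ^+ 2 -> 0 < eps ->
  (forall x : 'rV[R]_3, forall u, dotprod u x = u 0 i0 * x 0 i0 + u 0 i1 * x 0 i1 + u 0 i2 * x 0 i2) ->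
  (forall u, u \in us -> good_normal u) ->
  sorted (fun a b => a <= b) (map slope us) ->
  segment_convex (@unit_ball R 3) ->
  (112 * (2 * N).+1)%:R < (size us)%:R * eps ->
  shaves eps (@unit_ball R 3) us = set0.
Proof.
move=> N0 eN e0 dE gus sus cB big; apply/eqP; apply: contrapT => /negP/set0P ne.
have B0 : @unit_ball R 3 !=set0 by case: ne => x /shaves_subset; exists x.
have m1 : `|-1 : R| <= 1 by rewrite normrN normr1.
have p1 : `|1 : R| <= 1 by rewrite normr1.
have pus : path (fun a b => a <= b) (-1) (map slope us).
  rewrite path_min_sorted // all_map; apply/allP => u /gus[_ u0 h _] /=.
  suff : `|slope u| <= 1 by rewrite ler_norml => /andP[].
  by rewrite /slope normrM normfV (gtr0_norm u0) ler_pdivrMr // mul1r.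
have := potential_shaves N0 eN e0 dE cB (@subset_refl _ _) m1 gus pus ne.
have := potential_bound N0 B0 (@subset_refl _ _) m1.
have := potential_bound N0 ne (@shaves_subset _ _ _ _) p1.
move: big; rewrite !natrM => big.
rewrite !ler_norml => /andP[h1 _] /andP[_ h2]; lra.
Qed.

End Potential.

(** * From successive shaves to coverings by planks *)

Lemma dotprod_le1 (R : realType) (d : nat) (u x : 'rV[R]_d) :
  unit_ball u -> unit_ball x -> dotprod u x <= 1.
Proof.
rewrite /unit_ball /= !euclidean_norm_le1 => hu hx.
have := dotprod_ge0 (u - x).
rewrite dotprodBr dotprodC dotprodBr [dotprod (u - x) x]dotprodC dotprodBr.
rewrite (dotprodC x u); lra.
Qed.

Lemma unit_ball_convex (R : realType) (d : nat) : segment_convex (@unit_ball R d).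
Proof.
move=> x y t Bx By /andP[t0 t1]; have xy := dotprod_le1 Bx By.
move: Bx By; rewrite /unit_ball /= !euclidean_norm_le1 => Bx By.
have -> : x + t *: (y - x) = (1 - t) *: x + t *: y.
  by rewrite scalerBr scalerBl scale1r addrA addrAC.
rewrite dotprodDr !dotprodZr !(dotprodC (_ + _)) !dotprodDr !dotprodZr (dotprodC y x).
have : 0 <= (1 - t) ^+ 2 * (1 - dotprod x x) by rewrite mulr_ge0 ?sqr_ge0 // subr_ge0.
have : 0 <= t ^+ 2 * (1 - dotprod y y) by rewrite mulr_ge0 ?sqr_ge0 // subr_ge0.
have : 0 <= (t * (1 - t)) * (1 - dotprod x y).
  by rewrite !mulr_ge0 // ?subr_ge0.
lra.
Qed.

Lemma shaves_convex (R : realType) (d : nat) (eps : R) (K : set 'rV[R]_d) us :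
  segment_convex K -> segment_convex (shaves eps K us).
Proof. by elim: us K => [//|u us IH] K cK; apply: IH; exact: shave_convex. Qed.

Lemma uncovered0 (R : realType) (d f : nat) (K : set 'rV[R]_d)
    (P : 'I_f -> set 'rV[R]_d) (sigma : 'S_f) : uncovered K P sigma 0 = K.
Proof. by apply/seteqP; split=> [x []//|x Kx]; split=> // -[i]. Qed.

Lemma uncoveredS (R : realType) (d f : nat) (K : set 'rV[R]_d)
    (P : 'I_f -> set 'rV[R]_d) (sigma : 'S_f) (j : 'I_f) :
  uncovered K P sigma j.+1 = uncovered K P sigma j `\` P (sigma j).
Proof.
apply/seteqP; split=> x.
  move=> [Kx h]; split; last by move=> Pj; apply: h; exists j => //=; exact: ltnSn.
  by split=> // -[i /= ij Pi]; apply: h; exists i => //=; exact: ltnW.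
move=> [[Kx h] nPj]; split=> // -[i /=]; rewrite ltnS leq_eqVlt.
by move=> /orP[/eqP/val_inj -> //|ij] Pi; apply: h; exists i.
Qed.

(** With each plank translated until its upper face supports the remaining body, the uncovered sets
    are iterated shaves of the ball, hence convex and connected. *)
Lemma nondissective_shaves (R : realType) (d f : nat) (eps : R)
    (u : 'I_f -> 'rV[R]_d) (a : 'I_f -> R) (sigma : 'S_f) :
  (forall i, euclidean_norm (u i) = 1) ->
  shaves eps (@unit_ball R d) [seq u (sigma i) | i <- enum 'I_f] = set0 ->
  nondissective_translative_covering (@unit_ball R d)
    (fun i => [set x | a i <= dotprod (u i) x <= a i + eps]).
Proof.
move=> u1 fin; set l := [seq _ | i <- _] in fin.
pose K j := shaves eps (@unit_ball R d) (take j l).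
(* Plank [i] is used at step [sigma^-1 i], and [c i] is measured from the top of the body at that
   step; once the body is empty any position will do. *)
pose c i := sup (dotprod (u i) @` K ((sigma^-1)%g i)) - eps.
exists sigma, (fun i => (c i - a i) *: u i) => P'.
have P'E i : P' i = [set x | c i <= dotprod (u i) x <= c i + eps].
  rewrite /P' translate_plank dotprodZr.
  have /euclidean_norm_eq1 -> := u1 i.
  by rewrite mulr1 addrC subrK addrAC [a i + _]addrC subrK.
have KB j : K j `<=` @unit_ball R d by exact: shaves_subset.
have step (j : 'I_f) : K j.+1 = K j `\` P' (sigma j).
  have szl : size l = f by rewrite size_map size_enum_ord.
  have lj : nth 0 l j = u (sigma j).
    by rewrite (nth_map j) ?size_enum_ord // nth_ord_enum.
  rewrite /K (take_nth 0) ?szl // lj /shaves foldl_rcons -/(shaves _ _ _) -/(K j).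
  rewrite P'E /c permK; apply/seteqP; split=> x [Kx hx]; split=> //=.
    by move=> /andP[h _]; move: hx; rewrite /= ltNge h.
  rewrite ltNge; apply/negP => h; apply: hx; rewrite /= h subrK.
  apply: ub_le_sup; last by exists x.
  by exists 1 => _ [y /KB By <-]; apply: dotprod_le1 => //; rewrite /unit_ball /= u1.
have unc j : (j <= f)%N -> uncovered (@unit_ball R d) P' sigma j = K j.
  elim: j => [_|j IH jf]; first by rewrite uncovered0 /K take0.
  have := uncoveredS (@unit_ball R d) P' sigma (Ordinal jf); rewrite /= => ->.
  by rewrite (IH (ltnW jf)) -(step (Ordinal jf)).
split=> [j /andP[_ jf]|]; rewrite unc //.
  exact/convex_connected/shaves_convex/unit_ball_convex.
by rewrite /K take_oversize // size_map size_enum_ord.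
Qed.

(** This allows a chosen family of planks to be used first, in a prescribed order. *)
Lemma perm_prefix (f : nat) (s : seq 'I_f) : uniq s ->
  exists (sigma : 'S_f) (s' : seq 'I_f), [seq sigma i | i <- enum 'I_f] = s ++ s'.
Proof.
move=> us; pose l := s ++ [seq i <- enum 'I_f | i \notin s].
have ul : uniq l.
  rewrite cat_uniq us filter_uniq ?enum_uniq // andbT /=.
  by apply/hasPn => i; rewrite mem_filter => /andP[].
have lall i : i \in l by rewrite mem_cat mem_filter mem_enum andbT orbN.
have szl : size l = f.
  by rewrite -(card_uniqP ul) -[RHS](card_ord f); apply: eq_card => i; rewrite lall.
have inj : injective (fun j : 'I_f => nth j l j).
  move=> i j; rewrite (set_nth_default j) ?szl // => /eqP.
  by rewrite nth_uniq ?szl // => /eqP/val_inj.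
exists (perm inj), [seq i <- enum 'I_f | i \notin s]; rewrite -/l.
case: f => [|f] in s us l ul lall szl inj *; first by
  apply: etrans (esym (size0nil szl)); apply: size0nil; rewrite size_map size_enum_ord.
apply: (@eq_from_nth _ ord0); first by rewrite size_map size_enum_ord szl.
move=> i; rewrite size_map size_enum_ord => iF.
rewrite (nth_map ord0) ?size_enum_ord // permE nth_enum_ord //.
by apply: set_nth_default; rewrite szl.
Qed.

Lemma dotprod_perm3 (R : realType) (i0 : 'I_3) : exists i1 i2 : 'I_3,
  forall x u : 'rV[R]_3,
    dotprod u x = u 0 i0 * x 0 i0 + u 0 i1 * x 0 i1 + u 0 i2 * x 0 i2.
Proof.
pose o1 : 'I_3 := lift ord0 ord0; pose o2 : 'I_3 := lift ord0 (lift ord0 ord0).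
have E (x u : 'rV[R]_3) :
    dotprod u x = u 0 ord0 * x 0 ord0 + u 0 o1 * x 0 o1 + u 0 o2 * x 0 o2.
  by rewrite /dotprod !big_ord_recl big_ord0 addr0 addrA.
have : [\/ i0 = ord0, i0 = o1 | i0 = o2].
  by case: i0 => -[|[|[|//]]] h; [apply: Or31|apply: Or32|apply: Or33]; apply: val_inj.
by case=> ->; [exists o1, o2|exists ord0, o2|exists ord0, o1] => x u; rewrite E; ring.
Qed.

Lemma pigeonhole3 (f : nat) (m : 'I_f -> 'I_3) :
  exists k, (f <= 3 * #|[pred i | m i == k]|)%N.
Proof.
apply: contrapT => nex.
have h k : (3 * #|[pred i | m i == k]| < f)%N.
  by rewrite ltnNge; apply/negP => h; apply: nex; exists k.
have : (\sum_(k < 3) (3 * #|[pred i | m i == k]|) = 3 * f)%N.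
  rewrite -big_distrr /=; congr (_ * _)%N.
  rewrite -[RHS]card_ord -[RHS]sum1_card (partition_big m predT) //=.
  by apply: eq_bigr => k _; rewrite -sum1_card; apply: eq_bigl => i; rewrite inE.
rewrite !big_ord_recl big_ord0.
have := h ord0; have := h (lift ord0 ord0); have := h (lift ord0 (lift ord0 ord0)).
set A := (3 * _)%N; set B := (3 * _)%N; set C := (3 * _)%N => hA hB hC e.
have : (C + (B + (A + 0)) < 3 * f)%N; last by rewrite e ltnn.
by rewrite addn0 !mulSn mul0n addn0 -addSn leq_add // ltnW // -addSn leq_add // ltnW.
Qed.

Lemma plankN (R : realType) (d : nat) (u : 'rV[R]_d) (a eps : R) :
  [set x | a <= dotprod u x <= a + eps] =
  [set x | - (a + eps) <= dotprod (- u) x <= - (a + eps) + eps].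
Proof.
by apply/seteqP; split=> x /=; rewrite dotprodNl => /andP[h1 h2]; apply/andP; split; lra.
Qed.

(** At least a third of the planks share a dominant coordinate [i0]. Used first and by increasing
    slope, they exhaust the ball, whence [336 = 3 * 112]. *)
Lemma always_covers_of_many (R : realType) (eps : R) (f N : nat) :
  (0 < N)%N -> 4 <= eps * N%:R ^+ 2 -> 0 < eps ->
  (336 * (2 * N).+1)%:R < f%:R * eps -> always_covers 3 eps f.
Proof.
move=> N0 eN e0 fbig P Pplank.
have /boolp.choice[ua /all_and2[u1 PE]] : forall i, exists ua : 'rV[R]_3 * R,
    euclidean_norm ua.1 = 1 /\
    P i = [set x | ua.2 <= dotprod ua.1 x <= ua.2 + eps].
  by move=> i; have [u [a [h1 h2]]] := Pplank i; exists (u, a).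
have /boolp.choice[m hm] : forall i, exists k, forall k', `|(ua i).1 0 k'| <= `|(ua i).1 0 k|.
  move=> i; case: (@arg_maxP _ _ _ (ord0 : 'I_3) predT (fun k => `|(ua i).1 0 k|) isT) => k _ h.
  by exists k => k'; exact: h.
have [i0 hf] := pigeonhole3 m.
have [i1 [i2 dE]] := dotprod_perm3 R i0.
(* Reversing the normal describes the same plank, so the dominant coordinate may be taken
   positive. *)
pose u i := if 0 < (ua i).1 0 i0 then (ua i).1 else - (ua i).1.
pose a i := if 0 < (ua i).1 0 i0 then (ua i).2 else - ((ua i).2 + eps).
have -> : P = fun i => [set x | a i <= dotprod (u i) x <= a i + eps].
  by apply/funext => i; rewrite PE /a /u; case: ifP => // _; rewrite plankN.
have u1' i : euclidean_norm (u i) = 1.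
  rewrite /u; case: ifP => // _; apply/euclidean_norm_eq1.
  by rewrite dotprodNl dotprodC dotprodNl opprK; apply/euclidean_norm_eq1.
have uabs i k : `|u i 0 k| = `|(ua i).1 0 k|.
  by rewrite /u; case: ifP => // _; rewrite mxE normrN.
pose G := [pred i | m i == i0].
have Ggood i : i \in G -> good_normal i0 i1 i2 (u i).
  rewrite inE => /eqP mi.
  have le k : `|u i 0 k| <= `|u i 0 i0| by rewrite !uabs -mi hm.
  have u0 : 0 < u i 0 i0.
    have ge : 0 <= u i 0 i0.
      by rewrite /u; case: ltP => [/ltW //|h]; rewrite mxE oppr_ge0.
    rewrite lt_neqAle ge andbT eq_sym; apply/eqP => u0.
    have z k : u i 0 k = 0 by apply/eqP; rewrite -normr_le0 (le_trans (le k)) // u0 normr0.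
    have /euclidean_norm_eq1 := u1' i; rewrite dE !z !mul0r !addr0 => /eqP.
    by rewrite eq_sym oner_eq0.
  by split=> //; rewrite -[leRHS]gtr0_norm.
pose r := relpre (fun i => slope i0 i1 (u i)) (fun x y : R => x <= y).
pose s := sort r (enum G).
have [|sigma [s' hs]] := perm_prefix (s := s); first by rewrite sort_uniq enum_uniq.
have ex : shaves eps (@unit_ball R 3) (map u s) = set0.
  apply: (@shaves_exhaust _ i0 i1 i2 N) => //.
  - by move=> _ /mapP[i + ->]; rewrite mem_sort mem_enum; exact: Ggood.
  - rewrite -map_comp sorted_map; apply: sort_sorted => i j; exact: le_total.
  - exact: unit_ball_convex.
  - rewrite size_map size_sort -cardE.
    have : f%:R <= 3 * #|G|%:R :> R by rewrite -natrM ler_nat.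
    move: fbig; rewrite !natrM => h1 h2.
    have := ler_wpM2r (ltW e0) h2; lra.
apply: (@nondissective_shaves _ _ _ _ _ _ sigma) => //.
(* The remaining planks shave the empty set. *)
rewrite (map_comp u sigma) hs map_cat /shaves foldl_cat.
rewrite [foldl _ _ (map u s)]ex.
by rewrite -subset0; exact: shaves_subset.
Qed.

(** * Choice of parameters and conclusion *)

(** For width [d ^+ 4], [N] of order [d ^- 2] satisfies the grid condition, and a number of planks
    of order [N / d ^+ 4], that is [d ^- 6], suffices; this is weakened to [d ^- 7]. *)
Lemma upper_cover (R : realType) (d : R) : 0 < d -> d < 1 ->
  exists f : nat, [/\ (0 < f)%N, always_covers 3 (d ^+ 4) f &
    f%:R <= 5000 * d ^- 7].
Proof.
move=> d0 d1.
pose N := (Num.truncn (2 * d ^- 2)).+1.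
have d2 : 0 < d ^- 2 by rewrite invr_gt0 exprn_gt0.
have d2' : 1 <= d ^- 2 by rewrite invf_ge1 ?exprn_gt0 // exprn_ile1 // ltW.
have /truncn_itv/andP[N1 N2] : 0 <= 2 * d ^- 2 by lra.
rewrite -/N in N2.
have N3 : N%:R <= 3 * d ^- 2 by rewrite /N -natr1; lra.
have d4 : 0 < d ^+ 4 by rewrite exprn_gt0.
pose b : R := (336 * (2 * N).+1)%:R / d ^+ 4.
have b0 : 0 <= b := divr_ge0 (ler0n _ _) (ltW d4).
have /truncn_itv/andP[f1 f2] := b0.
exists (Num.truncn b).+1; split=> //.
  apply: (@always_covers_of_many _ _ _ N) => //; last by rewrite -ltr_pdivrMr.
  have : (2 * d ^- 2) ^+ 2 <= N%:R ^+ 2.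
    by rewrite ler_pXn2r ?nnegrE ?mulr_ge0 // ltW.
  move=> /(ler_wpM2l (ltW d4)).
  by have -> : d ^+ 4 * (2 * d ^- 2) ^+ 2 = 4 by field; rewrite gt_eqF.
have bb : b <= 2352 * d ^- 6.
  rewrite /b ler_pdivrMr // natrM -[(2 * N).+1%:R]natr1 [(2 * N)%:R]natrM.
  have -> : 2352 * d ^- 6 * d ^+ 4 = 2352 * d ^- 2 by field; rewrite gt_eqF.
  lra.
have d67 : d ^- 6 <= d ^- 7.
  by rewrite lef_pV2 ?posrE ?exprn_gt0 // ler_wiXn2l // ltW.
have d6 : 1 <= d ^- 6 by rewrite invf_ge1 ?exprn_gt0 // exprn_ile1 // ltW.
by rewrite -natr1; lra.
Qed.

Unset Implicit Arguments.

Theorem theorem1 (R : realType) :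
  exists c C : R, 0 < c /\ 0 < C /\
    forall eps : R, 0 < eps -> eps < 1 ->
      c * eps `^ (- (4 / 3)) <= (nondissective_number 3 eps)%:R /\
      (nondissective_number 3 eps)%:R <= C * eps `^ (- (7 / 4)).
Proof.
exists 10000^-1, 5000; split; first by lra.
split=> [|eps e0 e1]; first by lra.
(* A root of [eps] turns the fractional powers into integer ones: the upper bound uses [k = 4], the
   lower bound [k = 3]. *)
have root (k : nat) : (0 < k)%N -> let d := eps `^ k%:R^-1 in
    [/\ 0 < d, d < 1, eps = d ^+ k & forall j : nat, eps `^ (- (j%:R / k%:R)) = d ^- j].
  move=> k0 d; have d0 : 0 < d by exact: powR_gt0.
  have dk : d ^+ k = eps.
    by rewrite /d -powR_mulrn ?powR_ge0 // -powRrM mulVf ?powRr1 ?ltW // pnatr_eq0 -lt0n.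
  split=> // [|j].
    rewrite ltNge; apply/negP => /(exprn_ege1 k); rewrite dk; lra.
  by rewrite powRN mulrC powRrM powR_mulrn ?powR_ge0.
have [f [f0 cov fle]] : exists f : nat, [/\ (0 < f)%N, always_covers 3 eps f &
    f%:R <= 5000 * eps `^ (- (7 / 4))].
  have [d0 d1 epsE dj] := root 4 isT; have [f [f0 cov fle]] := upper_cover d0 d1.
  by exists f; rewrite {1}epsE (dj 7).
(* The covering just found yields a least admissible number, so [xget] does not return its default
   0. *)
have [g [g0 gcov gmin]] : exists g : nat, [/\ (0 < g)%N, always_covers 3 eps g &
    forall h : nat, (0 < h)%N -> always_covers 3 eps h -> (g <= h)%N].
  have ex : exists g : nat, (0 < g)%N && `[<always_covers 3 eps g>].
    by exists f; rewrite f0; apply/asboolP.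
  case: (ex_minnP ex) => g /andP[g0 /asboolP gcov] gmin; exists g; split=> // h h0 hcov.
  by apply: gmin; rewrite h0; apply/asboolP.
have [n0 ncov nmin] : [/\ (0 < nondissective_number 3 eps)%N,
    always_covers 3 eps (nondissective_number 3 eps) &
    forall h : nat, (0 < h)%N -> always_covers 3 eps h ->
      (nondissective_number 3 eps <= h)%N].
  rewrite /nondissective_number.
  by apply: (@xgetPex _ 0%N [set f : nat | [/\ (0 < f)%N, always_covers 3 eps f & _]]);
    exists g.
split; last by apply: le_trans fle; rewrite ler_nat; exact: nmin.
have [d0 d1 epsE dj] := root 3 isT.
by rewrite (dj 4); apply: lower_bound_cube; rewrite -?epsE.
Qed.
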